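(* Let $\alpha>0$, $T>0$ and $0<\varepsilon_1<\dots<\varepsilon_n\le 1$ be as in the context, with $T\ge 2\max_i(\varepsilon_i)/\alpha$, and let $B_i(t)=e^{-\alpha t/\varepsilon_i}$. For all $i,j$ with $1\le i<j\le n$, the point $t_{i,j}\in[0,\infty)$ defined by $$\frac{B_i(t_{i,j})}{\varepsilon_i}=\frac{B_j(t_{i,j})}{\varepsilon_j}$$ exists and is uniquely defined, and it satisfies $$\varepsilon_i^{-1}B_i(t)>\varepsilon_j^{-1}B_j(t)\quad\text{for } t\in[0,t_{i,j}),\qquad \varepsilon_i^{-1}B_i(t)<\varepsilon_j^{-1}B_j(t)\quad\text{for } t\in(t_{i,j},\infty).$$ In addition, the following ordering holds (for indices in $\{1,\dots,n\}$): $$t_{i,j}<t_{i+1,j}\ \text{ if } i+1<j,\qquad\text{and}\qquad t_{i,j}<t_{i,j+1}\ \text{ if } i<j,$$ and, for all $i<j$, $\varepsilon_i\le\varepsilon_j/2$ implies that $t_{i,j}\in(0,T]$.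
   Context: Here $n\ge 1$ is an integer, $\varepsilon_1,\dots,\varepsilon_n$ are the singular perturbation parameters of the system $E\vec u'(t)+A(t)\vec u(t)=\vec f(t)$ on $(0,T]$, $E=\mathrm{diag}(\varepsilon_1,\dots,\varepsilon_n)$, and $\alpha$ is any number with $0<\alpha<\min_{t\in[0,T],\,1\le i\le n}\sum_{j=1}^n a_{ij}(t)$, where $A(t)=(a_{ij}(t))$ is an $n\times n$ matrix function satisfying, for all $t\in[0,T]$, $a_{ii}(t)>\sum_{j\neq i}|a_{ij}(t)|$ for $1\le i\le n$ and $a_{ij}(t)\le 0$ for $i\ne j$. The functions $B_i$ are defined on $[0,\infty)$. *)

(* Defs.v *)
From HB Require Import structures.
From mathcomp Require Import all_boot all_order all_algebra.
From mathcomp Require Import all_classical all_reals all_analysis.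

Set Implicit Arguments.
Unset Strict Implicit.
Unset Printing Implicit Defensive.

Import Order.TTheory GRing.Theory Num.Theory.

Local Open Scope classical_set_scope.
Local Open Scope ring_scope.

(* The indices 1, ..., n are represented by 'I_n, i.e. shifted to 0, ..., n-1. *)

Definition is_minimum (R : realType) (S : set R) (m : R) : Prop :=
  S m /\ lbound S m.

Definition row_sums (R : realType) (n : nat) (T : R) (A : R -> 'M[R]_n) :
    set R :=
  [set x | exists t i, t \in `[0, T] /\ x = \sum_(j < n) A t i j].

(* The layer function B_i(t) = e^{-alpha t / eps_i}. It is total on R; only
   its values on [0, +oo[ are meaningful. *)
Definition layer (R : realType) (n : nat) (alpha : R) (eps : 'I_n -> R)
    (i : 'I_n) (t : R) : R :=
  expR (- (alpha * t / eps i)).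

(* s plays the role of t_{i,j}. *)
Definition is_layer_point (R : realType) (n : nat) (alpha : R)
    (eps : 'I_n -> R) (i j : 'I_n) (s : R) : Prop :=
  0 <= s /\ layer alpha eps i s / eps i = layer alpha eps j s / eps j.

(* Main.v *)
Require Import Defs.
From HB Require Import structures.
From mathcomp Require Import all_boot all_order all_algebra.
From mathcomp Require Import all_classical all_reals all_analysis.
From mathcomp Require Import ring lra.

Set Implicit Arguments.
Unset Strict Implicit.
Unset Printing Implicit Defensive.

Import Order.TTheory GRing.Theory Num.Theory.

Local Open Scope classical_set_scope.
Local Open Scope ring_scope.

(** Put a = 1 / eps_i > b = 1 / eps_j.  Taking logarithms, the sign of
    B_i / eps_i - B_j / eps_j at s is the sign of (ln a - ln b) - alpha s (a - b),
    so alpha t_{i,j} is the slope of the chord of ln between b and a.  The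
    orderings then express the strict concavity of ln, and ln x <= x - 1 gives
    t_{i,j} <= eps_j / alpha. *)

Definition ln_slope (R : realType) (x y : R) : R := (ln y - ln x) / (y - x).

(** This is the strict inequality [1 + u < expR u] for nonzero [u], taken at [u = ln x]. *)
Lemma ln_lt_subr1 (R : realType) (x : R) : 0 < x -> x != 1 -> ln x < x - 1.
Proof.
move=> x_gt0 x_neq1.
have lnx_neq0 : ln x != 0 by rewrite ln_eq0.
have := expR_gt1Dx lnx_neq0; rewrite lnK ?posrE//; lra.
Qed.

Lemma ln_slope_gt0 (R : realType) (x y : R) : 0 < x -> x < y -> 0 < ln_slope x y.
Proof.
move=> x_gt0 xy; rewrite divr_gt0 ?subr_gt0 ?ltr_ln ?posrE//.
exact: lt_trans xy.
Qed.

(** Apply [ln u < u - 1] to [u = y / x]; the same inequality at [u = x / y] yields the companion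
    bound at the other endpoint. *)
Lemma ln_slope_lt_inv (R : realType) (x y : R) :
  0 < x -> x < y -> ln_slope x y < x^-1.
Proof.
move=> x_gt0 xy; have y_gt0 := lt_trans x_gt0 xy.
have yx_neq1 : y / x != 1.
  by apply/eqP => /divr1_eq E; move: xy; rewrite E ltxx.
rewrite ltr_pdivrMr ?subr_gt0// mulrC mulrBl divff ?gt_eqF//.
rewrite -ln_div ?posrE//; apply: ln_lt_subr1 => //; exact: divr_gt0.
Qed.

Lemma ln_slope_gt_inv (R : realType) (x y : R) :
  0 < x -> x < y -> y^-1 < ln_slope x y.
Proof.
move=> x_gt0 xy; have y_gt0 := lt_trans x_gt0 xy.
have xy_neq1 : x / y != 1.
  by apply/eqP => /divr1_eq E; move: xy; rewrite E ltxx.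
rewrite ltr_pdivlMr ?subr_gt0// mulrC mulrBl divff ?gt_eqF//.
have := ln_lt_subr1 (divr_gt0 x_gt0 y_gt0) xy_neq1.
rewrite ln_div ?posrE//; lra.
Qed.

(** The derivative [y^-1] of [ln] at the middle point separates the slopes of the two short chords,
    and the slope of the long chord is their mean with positive weights [y - x] and [z - y]. *)
Lemma ln_slope_anti (R : realType) (x y z : R) : 0 < x -> x < y -> y < z ->
  ln_slope y z < ln_slope x z < ln_slope x y.
Proof.
move=> x_gt0 xy yz; have xz := lt_trans xy yz.
have slope_yz_xy : ln_slope y z < ln_slope x y.
  apply: lt_trans (ln_slope_gt_inv x_gt0 xy).
  exact: ln_slope_lt_inv (lt_trans x_gt0 xy) yz.
have slopeE (u v : R) : u < v -> ln_slope u v * (v - u) = ln v - ln u.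
  by move=> uv; rewrite divfK// subr_eq0 gt_eqF.
have mediant : ln_slope x z * (z - x)
    = ln_slope x y * (y - x) + ln_slope y z * (z - y).
  by rewrite !slopeE//; ring.
by apply/andP; split; nra.
Qed.

Section LayerCrossing.
Variables (R : realType) (n : nat) (alpha : R) (eps : 'I_n -> R).
Hypothesis alpha_gt0 : 0 < alpha.
Hypothesis eps_gt0 : forall i, 0 < eps i.

Definition crossing (i j : 'I_n) : R :=
  ln_slope (eps j)^-1 (eps i)^-1 / alpha.

Lemma scaled_layerE (i : 'I_n) (s : R) :
  (eps i)^-1 * layer alpha eps i s
  = expR (ln (eps i)^-1 - alpha * s * (eps i)^-1).
Proof. by rewrite expRD lnK// posrE invr_gt0. Qed.

(** Both exponents are affine in [s]. Once the positive denominators [alpha] and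
    [(eps i)^-1 - (eps j)^-1] are cleared, the two inequalities have the same difference of
    sides. *)
Lemma scaled_layer_lt (i j : 'I_n) (s : R) : eps i < eps j ->
  ((eps j)^-1 * layer alpha eps j s < (eps i)^-1 * layer alpha eps i s)
  = (s < crossing i j).
Proof.
move=> eps_ij; rewrite !scaled_layerE ltr_expR ltr_pdivlMr// ltr_pdivlMr.
  by rewrite -subr_gt0 -[RHS]subr_gt0; congr (0 < _); ring.
by rewrite subr_gt0 ltf_pV2 ?posrE.
Qed.

Lemma scaled_layer_gt (i j : 'I_n) (s : R) : eps i < eps j ->
  ((eps i)^-1 * layer alpha eps i s < (eps j)^-1 * layer alpha eps j s)
  = (crossing i j < s).
Proof.
move=> eps_ij; rewrite !scaled_layerE ltr_expR ltr_pdivrMr// ltr_pdivrMr.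
  by rewrite -subr_gt0 -[RHS]subr_gt0; congr (0 < _); ring.
by rewrite subr_gt0 ltf_pV2 ?posrE.
Qed.

Lemma crossing_gt0 (i j : 'I_n) : eps i < eps j -> 0 < crossing i j.
Proof.
by move=> eps_ij; rewrite divr_gt0// ln_slope_gt0 ?invr_gt0// ltf_pV2 ?posrE.
Qed.

(** The chord of [ln] starts at [(eps j)^-1], where the tangent has slope [eps j]. *)
Lemma crossing_le (i j : 'I_n) : eps i < eps j -> crossing i j <= eps j / alpha.
Proof.
move=> eps_ij; rewrite ler_pM2r ?invr_gt0// -[leRHS]invrK.
by apply/ltW/ln_slope_lt_inv; rewrite ?invr_gt0// ltf_pV2 ?posrE.
Qed.

(** Reciprocals reverse the order, so the three points of the chord comparison are
    [(eps j)^-1 < (eps k)^-1 < (eps i)^-1]. *)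
Lemma crossing_mono (i k j : 'I_n) : eps i < eps k -> eps k < eps j ->
  crossing i k < crossing i j < crossing k j.
Proof.
move=> eps_ik eps_kj; rewrite !ltr_pM2r ?invr_gt0//.
by apply: ln_slope_anti; rewrite ?invr_gt0 ?ltf_pV2 ?posrE.
Qed.

Lemma layer_pointP (i j : 'I_n) (s : R) : eps i < eps j ->
  is_layer_point alpha eps i j s <-> s = crossing i j.
Proof.
move=> eps_ij; have lt_s := scaled_layer_lt s eps_ij.
have gt_s := scaled_layer_gt s eps_ij.
rewrite /is_layer_point ![layer _ _ _ _ / _]mulrC; split=> [[_ layer_eq]|s_eq].
  (* By trichotomy, equality of the scaled layers excludes both strict comparisons of [s] with the
     crossing; the converse below runs the same way. *)
  by apply/eqP; rewrite eq_le !leNgt -lt_s -gt_s layer_eq ltxx.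
split; first by rewrite s_eq ltW// crossing_gt0.
by apply/eqP; rewrite eq_le !leNgt lt_s gt_s s_eq ltxx.
Qed.

End LayerCrossing.

Theorem lemma2p6 (R : realType) (n : nat) (n_ge1 : (1 <= n)%N)
  (T : R) (T_gt0 : 0 < T)
  (A : R -> 'M[R]_n)
  (A_dominant : forall (t : R) (i : 'I_n), t \in `[0, T] ->
     \sum_(j < n | j != i) `|A t i j| < A t i i)
  (A_offdiag : forall (t : R) (i j : 'I_n), t \in `[0, T] -> i != j ->
     A t i j <= 0)
  (m : R) (m_min : is_minimum (row_sums T A) m)
  (alpha : R) (alpha_gt0 : 0 < alpha) (alpha_lt_min : alpha < m)
  (eps : 'I_n -> R)
  (eps_gt0 : forall i : 'I_n, 0 < eps i)
  (eps_le1 : forall i : 'I_n, eps i <= 1)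
  (eps_incr : forall i j : 'I_n, (i < j)%N -> eps i < eps j)
  (T_large : 2 * (\big[Num.max/0]_(i < n) eps i) / alpha <= T) :
  (forall i j : 'I_n, (i < j)%N ->
     exists! s : R, is_layer_point alpha eps i j s) /\
  (forall t : 'I_n -> 'I_n -> R,
     (forall i j : 'I_n, (i < j)%N -> is_layer_point alpha eps i j (t i j)) ->
     (forall i j : 'I_n, (i < j)%N ->
        (forall s : R, 0 <= s < t i j ->
           (eps i)^-1 * layer alpha eps i s > (eps j)^-1 * layer alpha eps j s)
        /\
        (forall s : R, t i j < s ->
           (eps i)^-1 * layer alpha eps i s < (eps j)^-1 * layer alpha eps j s))
     /\
     (forall i i' j : 'I_n, i' = i.+1 :> nat -> (i' < j)%N ->
        t i j < t i' j) /\
     (forall i j j' : 'I_n, (i < j)%N -> j' = j.+1 :> nat ->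
        t i j < t i j') /\
     (forall i j : 'I_n, (i < j)%N -> eps i <= eps j / 2 ->
        0 < t i j <= T)).
Proof.
have pointP (i j : 'I_n) s (ij : (i < j)%N) :=
  layer_pointP alpha_gt0 eps_gt0 s (eps_incr i j ij).
split=> [i j ij|t tP].
  exists (crossing alpha eps i j); split; first exact/pointP.
  by move=> s /(pointP _ _ _ ij).
have tE (i j : 'I_n) (ij : (i < j)%N) : t i j = crossing alpha eps i j.
  exact/pointP/tP.
split=> [i j ij|].
  have eps_ij := eps_incr i j ij.
  rewrite tE//; split=> s; first by case/andP=> _; rewrite scaled_layer_lt.
  by rewrite scaled_layer_gt.
split=> [i k j kE kj|].
  have ik : (i < k)%N by rewrite kE.
  rewrite !tE ?(ltn_trans ik kj)//.
  by have /andP[] := crossing_mono alpha_gt0 eps_gt0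
    (eps_incr i k ik) (eps_incr k j kj).
split=> [i k j ik jE|i j ij _].
  have kj : (k < j)%N by rewrite jE.
  rewrite !tE ?(ltn_trans ik kj)//.
  by have /andP[] := crossing_mono alpha_gt0 eps_gt0
    (eps_incr i k ik) (eps_incr k j kj).
have eps_ij := eps_incr i j ij.
rewrite tE// crossing_gt0//=; apply: le_trans T_large.
apply: le_trans (crossing_le alpha_gt0 eps_gt0 eps_ij) _.
(* It remains to bound [eps j] by twice the maximum: [eps j] is at most the maximum, and doubling
   only increases it since [eps j] is positive. *)
rewrite ler_pM2r ?invr_gt0//.
have eps_max : eps j <= \big[Num.max/0]_(k < n) eps k by exact: le_bigmax.
have := eps_gt0 j; lra.
Qed.
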